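(* There exist an absolute constant $C>0$ and a sequence $(\delta_n)_{n\ge 1}$ of real numbers with $\delta_n\to 0$ as $n\to\infty$ (not depending on $k$) such that for all integers $2\le k<n$, all but at most a $\delta_n$ fraction of the $(n-k)$-symmetric functions $f:\mathbb{Z}_2^n\to\mathbb{Z}_2$ are $q$-locally correctable for $\varepsilon=0.001$ by an algorithm using $q\le C\,k\log^2 k$ non-adaptive queries.
   Context: For $f:\mathbb{Z}_2^n\to\mathbb{Z}_2$ and a permutation $\sigma\in\mathcal{S}_n$, let $f_\sigma(x_1,\dots,x_n)=f(x_{\sigma(1)},\dots,x_{\sigma(n)})$; such an $f_\sigma$ is called an isomorphism of $f$. Two functions $f,g:\mathbb{Z}_2^n\to\mathbb{Z}_2$ are $\varepsilon$-close if $\Pr_x[f(x)\ne g(x)]\le\varepsilon$ for uniformly random $x\in\mathbb{Z}_2^n$. Local correction: $f$ (known to the algorithm) is $q$-locally correctable for $\varepsilon>0$ if there is a randomized algorithm which, for every $\sigma\in\mathcal{S}_n$, every $g$ that is $\varepsilon$-close to $f_\sigma$, and every $x\in\mathbb{Z}_2^n$, given $x$ and black-box (query) access to $g$ (but not $\sigma$), outputs $f_\sigma(x)$ with probability at least $2/3$ using at most $q$ queries to $g$. The algorithm is non-adaptive if its query points do not depend on answers to earlier queries (they may depend on $f$, on $x$ and on the algorithm's randomness). No restriction is put on computation time. A function $f:\mathbb{Z}_2^n\to\mathbb{Z}_2$ is $t$-symmetric if there is a set of $t$ variables such that any reordering of these variables does not change $f$. Equivalently, $f$ is $(n-k)$-symmetric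 if there is a set $J$ of $k$ variables (the asymmetric variables) such that $f(x)$ is determined by $x_J$ and the Hamming weight of the remaining $n-k$ coordinates; the core of $f$ is the corresponding function $f_{\mathrm{core}}:\mathbb{Z}_2^k\times\{0,1,\dots,n-k\}\to\mathbb{Z}_2$. Local correctability is invariant under isomorphism of $f$, and the fraction of $(n-k)$-symmetric functions having a property is measured by choosing the core uniformly at random among all functions $\mathbb{Z}_2^k\times\{0,\dots,n-k\}\to\mathbb{Z}_2$ (with a fixed set $J$ of $k$ asymmetric variables). *)

(* Defs.v *)
From HB Require Import structures.
From mathcomp Require Import all_boot all_order all_fingroup all_algebra.
From mathcomp Require Import boolp reals topology normedtype.
From mathcomp Require Import sequences exp.

Set Implicit Arguments.
Unset Strict Implicit.
Unset Printing Implicit Defensive.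

Import Order.TTheory GRing.Theory Num.Theory.

Local Open Scope ring_scope.

(* Z_2^n, with Z_2 represented by bool; nothing below uses the addition of
   Z_2, only the number of coordinates equal to 1. *)
Definition cube (n : nat) := {ffun 'I_n -> bool}.

Definition permute n (f : cube n -> bool) (s : 'S_n) : cube n -> bool :=
  fun x => f [ffun i => x (s i)].

Definition close (R : realType) n (eps : R) (f g : cube n -> bool) : Prop :=
  #|[pred x : cube n | f x != g x]|%:R / #|{: cube n}|%:R <= eps.

(* A randomized non-adaptive algorithm on input x in Z_2^n making at most q
   queries to an unknown function.  The random choices w are drawn from a
   finite probability space; the list of query points is a function of x and w
   alone, and the output is a function of x, w and the list of answers.  There
   is no loss in taking the space finite: for given n and q there are only
   finitely many deterministic behaviours. *)
Record nonadaptive_algorithm (R : realType) (n q : nat) := NonadaptiveAlgorithm {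
  coins : finType;
  coin_prob : coins -> R;
  coin_prob_ge0 : forall w, 0 <= coin_prob w;
  coin_prob_sum1 : \sum_w coin_prob w = 1;
  queries : cube n -> coins -> seq (cube n);
  size_queries : forall x w, (size (queries x w) <= q)%N;
  output : cube n -> coins -> seq bool -> bool }.

Definition run (R : realType) n q (A : nonadaptive_algorithm R n q)
    (g : cube n -> bool) (x : cube n) (w : coins A) : bool :=
  output x w [seq g y | y <- queries x w].

(* f is known to the algorithm (A is chosen after f), whereas s is not. *)
Definition nonadaptively_locally_correctable (R : realType) n
    (f : cube n -> bool) (q : nat) (eps : R) : Prop :=
  exists A : nonadaptive_algorithm R n q,
    forall (s : 'S_n) (g : cube n -> bool), close eps g (permute f s) ->
    forall x : cube n,
      2 / 3 <= \sum_(w : coins A | run g x w == permute f s x) coin_prob w.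

Definition symmetric_in n (S : {set 'I_n}) (f : cube n -> bool) : Prop :=
  forall s : 'S_n, perm_on S s -> permute f s =1 f.

Definition t_symmetric n (t : nat) (f : cube n -> bool) : Prop :=
  exists2 S : {set 'I_n}, #|S| = t & symmetric_in S f.

Definition core (n k : nat) := {ffun cube k * 'I_(n - k).+1 -> bool}.

Section Core.
Variables (n k : nat) (J : {set 'I_n}) (hJ : #|J| = k).

(* x_J, with the elements of J listed in increasing order *)
Definition restrict (x : cube n) : cube k :=
  [ffun i => x (enum_val (cast_ord (esym hJ) i))].

Definition weight_out (x : cube n) : nat := #|[set i in ~: J | x i]|.

Lemma weight_out_lt x : (weight_out x < (n - k).+1)%N.
Proof.
have -> : (n - k)%N = #|~: J| by rewrite -hJ [RHS]cardsCs setCK card_ord.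
by rewrite ltnS; apply: subset_leq_card; apply/subsetP => i; rewrite inE => /andP[].
Qed.

Definition of_core (c : core n k) (x : cube n) : bool :=
  c (restrict x, Ordinal (weight_out_lt x)).

End Core.

(* For a fixed set J of k asymmetric variables, of_core is a bijection from the
   cores to the functions symmetric in the variables outside J. *)
Section CoreBijection.
Variables (n k : nat) (J : {set 'I_n}) (hJ : #|J| = k).

Lemma of_core_symmetric_in (c : core n k) : symmetric_in (~: J) (of_core hJ c).
Proof.
move=> s sJ x; rewrite /permute /of_core; congr (c (_, _)).
  apply/ffunP => i; rewrite !ffunE (out_perm sJ) // inE negbK.
  exact: enum_valP.
apply/val_inj => /=; rewrite /weight_out -[RHS](card_preimset _ (@perm_inj _ s)).
apply: eq_card => i; rewrite !inE ffunE; congr (_ && _).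
by have := perm_closed i sJ; rewrite !inE => ->.
Qed.

Lemma of_core_t_symmetric (c : core n k) : t_symmetric (n - k) (of_core hJ c).
Proof.
exists (~: J); last exact: of_core_symmetric_in.
by rewrite -hJ cardsCs setCK card_ord.
Qed.

Lemma restrict_eq (x y : cube n) :
  restrict hJ x = restrict hJ y -> forall i, i \in J -> x i = y i.
Proof.
move=> /ffunP e i iJ.
by have := e (cast_ord hJ (enum_rank_in iJ i)); rewrite !ffunE cast_ordK enum_rankK_in.
Qed.

Lemma symmetric_in_eq (f : cube n -> bool) (x y : cube n) : symmetric_in (~: J) f ->
  (forall i, i \in J -> x i = y i) -> weight_out J x = weight_out J y ->
  f x = f y.
Proof.
move=> fJ; have [m] := ubnP #|[set i | x i != y i]|.
elim: m x => // m IH x xym exy wxy.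
have [->//|/eqP nxy] := eqVneq x y.
pose X := [set i in ~: J | x i]; pose Y := [set i in ~: J | y i].
have cXY : #|X| = #|Y| by [].
have nXY : X != Y.
  apply/eqP => /setP e; apply: nxy; apply/ffunP => i.
  by have := e i; rewrite !inE; case: (boolP (i \in J)) => [/exy|].
have [i iX iY] : exists2 i, i \in X & i \notin Y.
  by apply/subsetPn; apply: contra nXY => h; rewrite eqEcard h cXY leqnn.
have [j jY jX] : exists2 j, j \in Y & j \notin X.
  by apply/subsetPn; apply: contra nXY => h; rewrite eq_sym eqEcard h cXY leqnn.
move: iX iY jY jX; rewrite !inE => /andP[iJ xi]; rewrite iJ /= => yi.
move=> /andP[jJ yj]; rewrite jJ /= => xj.
pose s := tperm i j.
have sJ : perm_on (~: J) s.
  apply/subsetP => l; rewrite !inE /s; case: tpermP => [->|->|_ _]; rewrite ?iJ ?jJ //.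
  by rewrite eqxx.
rewrite -[LHS](fJ s sJ) /permute; apply: IH => [|l lJ|].
- rewrite -ltnS; apply: leq_trans xym; rewrite ltnS.
  apply: proper_card; apply/properP; split.
    apply/subsetP => l; rewrite !inE ffunE /s.
    by case: tpermP => [->|->|//]; rewrite ?xi ?(negbTE yi) ?(negbTE xj) ?yj.
  by exists i; rewrite !inE ?ffunE /s ?tpermL ?xi ?(negbTE yi) ?(negbTE xj).
- by rewrite ffunE (out_perm sJ) ?exy // inE negbK.
- rewrite -wxy /weight_out -(card_preimset [set l in ~: J | x l] (@perm_inj _ s)).
  apply: eq_card => l; rewrite !inE ffunE; congr (_ && _).
  by have := perm_closed l sJ; rewrite !inE => ->.
Qed.

Lemma of_core_surj (f : cube n -> bool) :
  symmetric_in (~: J) f -> exists c : core n k, of_core hJ c =1 f.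
Proof.
move=> fJ.
exists [ffun p => if [pick x | (restrict hJ x, Ordinal (weight_out_lt hJ x)) == p]
                  is Some x then f x else false] => x.
rewrite /of_core ffunE; case: pickP => [y /eqP[e w]|/(_ x)]; last by rewrite eqxx.
exact: symmetric_in_eq (restrict_eq e) w.
Qed.

Lemma of_core_inj (c d : core n k) : of_core hJ c =1 of_core hJ d -> c = d.
Proof.
move=> e; apply/ffunP => -[y m].
have cJ : #|~: J| = (n - k)%N by rewrite -hJ cardsCs setCK card_ord.
have [T TJ cT] : exists2 T : {set 'I_n}, T \subset ~: J & #|T| = m.
  exists [set l in take m (enum (~: J))].
    by apply/subsetP => l; rewrite inE => /mem_take; rewrite mem_enum.
  rewrite cardsE (card_uniqP _) ?take_uniq ?enum_uniq // size_take -cardE cJ.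
  by have := ltn_ord m; rewrite ltnS leq_eqVlt => /orP[/eqP->|->//]; rewrite ltnn.
pose x : cube n := [ffun i =>
  if boolP (i \in J) is AltTrue iJ then y (cast_ord hJ (enum_rank_in iJ i))
  else i \in T].
have rx : restrict hJ x = y.
  apply/ffunP => i; rewrite !ffunE.
  case: {-}_ / boolP => [iJ|]; last by rewrite enum_valP.
  by rewrite enum_valK_in cast_ordKV.
have wx : Ordinal (weight_out_lt hJ x) = m.
  apply/val_inj; rewrite /= -cT; apply: eq_card => i; rewrite !inE ffunE.
  case: {-}_ / boolP => [iJ|iJ] /=; rewrite ?iJ //=.
  by apply/esym/negbTE; apply: contraL iJ => /(subsetP TJ); rewrite inE.
by have := e x; rewrite /of_core rx wx.
Qed.

End CoreBijection.

(* Main.v *)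
(** The corrector is a maximum agreement decoder.  Each hypothesis about the
    hidden permutation predicts the answers to all queries and the output; if
    hypotheses with different outputs predict different answers on a constant
    fraction of random queries, then O(log |H|) queries single out the right
    output among |H| hypotheses, as long as every query is uniform.

    When k^8 is larger than about n, the queries are independent and uniform and
    the hypotheses are the n^k placements of the asymmetric variables, so that
    O(k log n) = O(k log k) queries suffice.

    When k^8 is at most about n, four kinds of variables are enough.  Pick a
    uniform mask s and a block W of about n/(10k) variables, which probably
    misses all asymmetric variables.  A query is s + b(x) off W, with two random
    bits b(0), b(1), and random on W.  A hypothesis is the pair of restrictions
    of x and s to the asymmetric variables, so |H| = 4^k, and a wrong guess of x
    predicts a different row of the core with probability 1/2.  The randomness
    on W spreads the weight of the query over many columns, and on these two
    different rows of a random core differ about half of the time.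

    In both cases the probability that a random core fails is estimated by an
    exponential moment and a union bound over pairs of hypotheses. *)

Require Import Defs.
From mathcomp Require Import all_boot all_order all_fingroup all_algebra.
From mathcomp Require Import boolp classical_sets reals topology normedtype.
From mathcomp Require Import sequences exp.
From mathcomp Require Import zify ring lra.

Set Implicit Arguments.
Unset Strict Implicit.
Unset Printing Implicit Defensive.

Import Order.TTheory GRing.Theory Num.Theory.
Import numFieldNormedType.Exports.
Local Open Scope ring_scope.

(** * Exponential moments of disagreement counts *)

Lemma expRN_le_half (R : realType) (x : R) : 0 <= x <= 1 -> expR (- x) <= 1 - x / 2.
Proof.
move=> /andP[x0 x1]; rewrite expRN.
have h : 1 + x <= expR x by exact: expR_ge1Dx.
apply: (@le_trans _ _ (1 + x)^-1).
  by rewrite lef_pV2 ?posrE ?expR_gt0 //; lra.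
rewrite -div1r ler_pdivrMr; last lra.
nra.
Qed.

Lemma le_expRN (R : realType) (x : R) : 1 - x <= expR (- x).
Proof. exact: expR_ge1Dx. Qed.

Lemma natr_card (R : nzSemiRingType) (I : finType) (P : pred I) :
  #|P|%:R = \sum_(i : I) (P i)%:R :> R.
Proof.
rewrite -sum1_card natr_sum big_mkcond; apply: eq_bigr => i _.
by rewrite unfold_in; case: (P i).
Qed.

(* Flipping the values of [c] on [A] by an independent mask [d] preserves the
   counting measure; once [c] is fixed, the values of the mask at different
   points contribute independent factors to the exponential moment. *)
Lemma card_few_disagreements (R : realType) (D E : finType) (phi psi : E -> D)
    (A : {set D}) (E0 : {set E}) (mu al : R) :
  (forall e, e \in E0 -> phi e \in A /\ psi e \notin A) -> 0 < mu ->
  (forall a, #|[pred e in E0 | phi e == a]|%:R <= mu) ->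
  #|[pred c : {ffun D -> bool} |
      (#|[pred e in E0 | c (phi e) != c (psi e)]|%:R <= al)]|%:R <=
    #|{: {ffun D -> bool}}|%:R * expR ((al - #|E0|%:R / 4) / mu).
Proof.
move=> EA mu0 fib.
pose C := {ffun D -> bool}; change {ffun D -> bool} with C.
pose X (c : C) : R := #|[pred e in E0 | c (phi e) != c (psi e)]|%:R.
pose F (c : C) : R := expR (- X c / mu).
have C0 : 0 < #|{: C}|%:R :> R.
  by rewrite ltr0n; apply/card_gt0P; exists [ffun=> false].
suff FC : \sum_c F c <= #|{: C}|%:R * expR (- (#|E0|%:R / 4) / mu).
  rewrite natr_card; apply: (@le_trans _ _ (\sum_c expR (al / mu) * F c)).
    apply: ler_sum => c _; rewrite -expRD -mulrDl /=.
    have [h|_] := boolP (_ <= al); last exact: expR_ge0.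
    apply: le_trans (expR_ge1Dx _); rewrite lerDl divr_ge0 ?(ltW mu0) //.
    by rewrite subr_ge0.
  by rewrite -mulr_sumr mulrDl expRD mulrCA ler_pM2l ?expR_gt0.
pose mask (d c : C) : C := [ffun a => c a (+) ((a \in A) && d a)].
have maskK d : involutive (mask d).
  by move=> c; apply/ffunP => a; rewrite !ffunE -addbA addbb addbF.
have sumE : #|{: C}|%:R * (\sum_c F c) = \sum_(c : C) \sum_(d : C) F (mask d c).
  rewrite exchange_big /= [RHS](eq_bigr (fun=> \sum_c F c)).
    by rewrite big_const iter_addr addr0 mulr_natl.
  by move=> d _; rewrite [RHS](reindex_inj (inv_inj (maskK d))).
rewrite -(ler_pM2l C0) sumE.
have -> : #|{: C}|%:R * (#|{: C}|%:R * expR (- (#|E0|%:R / 4) / mu)) =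
    \sum_(c : C) (#|{: C}|%:R * expR (- (#|E0|%:R / 4) / mu)) :> R.
  by rewrite big_const iter_addr addr0 mulr_natl.
apply: ler_sum => c _.
(* [Y a b] counts the disagreements on the fibre over [a] when [c a] is flipped by [b]. As [psi e]
   lies outside [A], it is never flipped. *)
pose Y a b : R := #|[pred e in E0 | (phi e == a) && (c a (+) b != c (psi e))]|%:R.
have XY d : X (mask d c) = \sum_a Y a (d a).
  rewrite /X -sum1_card natr_sum (partition_big phi predT) //=.
  apply: eq_bigr => a _; rewrite /Y -sum1_card natr_sum; apply: eq_bigl => e.
  rewrite !inE !ffunE; have [eE|] //= := boolP (e \in E0).
  have [phiA /negbTE psiA] := EA e eE; rewrite phiA psiA addbF.
  by case: (eqVneq (phi e) a) => [->|]; rewrite ?andbT ?andbF.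
have Y0 a b : 0 <= Y a b by exact: ler0n.
have Ysum a : Y a true + Y a false = #|[pred e in E0 | phi e == a]|%:R.
  rewrite /Y -natrD -cardUI [X in (_ + X)%N]eq_card0 ?addn0.
    congr _%:R; apply: eq_card => e; rewrite !inE.
    by case: (e \in E0) (phi e == a) (c a) (c (psi e)) => [] [] [] [].
  by move=> e; rewrite !inE; case: (c a) (c (psi e)) => [] []; rewrite /= ?andbF.
rewrite (eq_bigr (fun d : C => \prod_a expR (- Y a (d a) / mu))); last first.
  by move=> d _; rewrite -expR_sum /F XY -mulr_suml sumrN.
rewrite -(bigA_distr_bigA (fun a b => expR (- Y a b / mu))) /=.
have -> : #|E0|%:R = \sum_a (Y a true + Y a false).
  rewrite -sum1_card natr_sum (partition_big phi predT) //=.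
  apply: eq_bigr => a _; rewrite Ysum -sum1_card natr_sum; apply: eq_bigl => e.
  by rewrite !inE.
have -> : #|{: C}|%:R = \prod_(a : D) 2 :> R.
  by rewrite prodr_const card_ffun card_bool natrX.
rewrite mulr_suml -sumrN mulr_suml expR_sum -big_split /=.
apply: ler_prod => a _; rewrite big_bool /=.
rewrite addr_ge0 ?expR_ge0 //=.
have := fib a; rewrite -Ysum => ha.
have le01 b : 0 <= Y a b / mu <= 1.
  rewrite divr_ge0 ?(ltW mu0) //= ler_pdivrMr // mul1r (le_trans _ ha) //.
  by case: b; rewrite ?lerDl ?lerDr.
rewrite !mulNr.
(* With [m] the size of the fibre over [a], the two factors sum to at most [2 - m / (2 * mu)], that
   is twice [1 - m / (4 * mu)]; hence the quarter in the exponent. *)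
have := expRN_le_half (le01 true); have := expRN_le_half (le01 false).
have := le_expRN ((Y a true + Y a false) / 4 / mu).
have -> : (Y a true + Y a false) / 4 / mu = (Y a true / mu + Y a false / mu) / 4 by ring.
lra.
Qed.

(** * Maximum agreement decoding *)

(** One coordinate of a uniform [w] is uniform; the factor [#|B|] on the left avoids an exponent
    [q - 1]. *)
Lemma sum_ffun_coord (R : comNzRingType) q (B : finType) (j : 'I_q) (F : B -> R) :
  #|B|%:R * \sum_(w : {ffun 'I_q -> B}) F (w j) = #|B|%:R ^+ q * \sum_b F b.
Proof.
rewrite (eq_bigr (fun w : {ffun 'I_q -> B} =>
    \prod_i if i == j then F (w i) else 1)); last first.
  by move=> w _; rewrite -big_mkcond /= big_pred1_eq.
rewrite -(bigA_distr_bigA (fun i b => if i == j then F b else 1)) /=.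
rewrite (bigD1 j) //= eqxx [X in _ * (_ * X)](eq_bigr (fun=> #|B|%:R)); last first.
  by move=> i ij; rewrite (negbTE ij) sumr_const.
rewrite prodr_const mulrCA -exprS mulrC; congr (_ ^+ _ * _).
by rewrite (cardC1 j) card_ord prednK // (leq_ltn_trans _ (ltn_ord j)).
Qed.

(* Decoding by maximum agreement: by Markov fewer than [q / 100] answers are
   corrupted except with probability 1/10, while by an exponential moment a wrong
   hypothesis differs from the right one on more than [q / 50] queries. *)
Lemma correctable_of_hypotheses (R : realType) n (f : cube n -> bool)
    (Om B H : finType) (h0 : H) (b0 : B)
    (z : cube n -> Om -> B -> cube n) (pr : cube n -> Om -> B -> H -> bool)
    (out : cube n -> H -> bool) (q : nat) : (0 < #|Om|)%N ->
  10 * #|H|%:R <= expR (q%:R / 200) :> R ->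
  (forall x (P : pred (cube n)),
    (#|[pred p : Om * B | P (z x p.1 p.2)]| * #|{: cube n}| = #|P| * #|{: Om * B}|)%N) ->
  (forall s x, exists2 bad : {set Om}, (10 * #|bad| <= #|Om|)%N &
    forall w, w \notin bad -> exists2 h : H,
      (forall b, pr x w b h = permute f s (z x w b)) /\ out x h = permute f s x &
      forall h', out x h' != out x h ->
        (#|B| <= 20 * #|[pred b | pr x w b h' != pr x w b h]|)%N) ->
  nonadaptively_locally_correctable f q (1 / 1000 : R).
Proof.
move=> Om0 Hq zunif good.
have N0 : 0 < #|{: Om * {ffun 'I_q -> B}}|%:R :> R.
  by rewrite ltr0n card_prod muln_gt0 Om0; apply/card_gt0P; exists [ffun=> b0].
have q0 : (0 < q)%N.
  case: q Hq {N0} => // /[!mul0r]; rewrite expR0.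
  have : 1 <= #|H|%:R :> R by rewrite ler1n; apply/card_gt0P; exists h0.
  lra.
have B0 : 0 < #|B|%:R :> R by rewrite ltr0n; apply/card_gt0P; exists b0.
pose disag x (w : Om * {ffun 'I_q -> B}) (ans : seq bool) h :=
  (\sum_(j < q) (pr x w.1 (w.2 j) h != nth false ans j))%N.
pose qs x (w : Om * {ffun 'I_q -> B}) := [seq z x w.1 (w.2 j) | j <- enum 'I_q].
have size_qs x w : (size (qs x w) <= q)%N by rewrite size_map size_enum_ord.
have prob_ge0 : 0 <= (#|{: Om * {ffun 'I_q -> B}}|%:R)^-1 :> R by rewrite invr_ge0 ltW.
have prob_sum1 : \sum_(w : Om * {ffun 'I_q -> B}) (#|{: Om * {ffun 'I_q -> B}}|%:R)^-1 = 1 :> R.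
  by rewrite sumr_const -[LHS]mulr_natl mulfV ?gt_eqF.
exists (NonadaptiveAlgorithm (fun=> prob_ge0) prob_sum1 size_qs
  (fun x w ans => out x [arg min_(h < h0) disag x w ans h]%N)).
move=> s g gclose x.
pose F := permute f s.
have [bad bad_small goodw] := good s x.
pose err (w : Om * {ffun 'I_q -> B}) : R := \sum_(j < q) (g (z x w.1 (w.2 j)) != F (z x w.1 (w.2 j)))%:R.
pose dist (w : Om * {ffun 'I_q -> B}) h : R := \sum_(j < q) (pr x w.1 (w.2 j) h != F (z x w.1 (w.2 j)))%:R.
pose I3 (w : Om * {ffun 'I_q -> B}) : R :=
  \sum_(h | (w.1 \notin bad) && (out x h != F x)) expR (q%:R / 50 - dist w h).
pose runw (w : Om * {ffun 'I_q -> B}) :=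
  out x [arg min_(h < h0) disag x w [seq g y | y <- qs x w] h]%N.
(* Either the output is right, or the shared coin is bad, or [q / 100] answers are corrupted, or a
   wrong hypothesis survives. The last three terms have mean at most 1/10 each, which leaves 7/10 >
   2/3. *)
have pointwise w : 1 <= (runw w == F x)%:R + (w.1 \in bad)%:R + err w * 100 / q%:R + I3 w.
  have qR0 : 0 < q%:R :> R by rewrite ltr0n.
  have err0 : 0 <= err w by apply: sumr_ge0.
  have e0 : 0 <= err w * 100 / q%:R by rewrite divr_ge0 ?mulr_ge0.
  have I0 : 0 <= I3 w by apply: sumr_ge0 => h _; exact: expR_ge0.
  have [_|rw] := eqVneq (runw w) (F x); first by have := ler0n R (w.1 \in bad); rewrite /=; lra.
  have [_|wb] := boolP (w.1 \in bad); first by rewrite /=; lra.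
  rewrite /= !add0r.
  have [le_err|lt_err] := leP (q%:R / 100) (err w).
    suff : 1 <= err w * 100 / q%:R by lra.
    by rewrite ler_pdivlMr // mul1r; lra.
  suff : 1 <= I3 w by lra.
  (* The winner [h] disagrees with the answers no more often than the true [h1], so it is within
     [2 * err w < q / 50] of the truth, and its term in [I3 w] is at least 1. *)
  move: rw; rewrite /runw; case: arg_minnP => //= h _ hmin outh.
  have [h1 [pr1 out1] _] := goodw _ wb.
  rewrite /I3 (bigD1 h) /=; last by rewrite wb.
  have rest0 : 0 <= \sum_(i | (w.1 \notin bad) && (out x i != F x) && (i != h))
      expR (q%:R / 50 - dist w i) by apply: sumr_ge0 => i _; exact: expR_ge0.
  suff dle : dist w h <= q%:R / 50.
    have := expR_ge1Dx (q%:R / 50 - dist w h); lra.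
  have nthE (j : 'I_q) : nth false [seq g y | y <- qs x w] j = g (z x w.1 (w.2 j)).
    by rewrite -map_comp (nth_map j) ?size_enum_ord // nth_ord_enum.
  have disE i : (disag x w [seq g y | y <- qs x w] i)%:R =
      \sum_(j < q) (pr x w.1 (w.2 j) i != g (z x w.1 (w.2 j)))%:R :> R.
    by rewrite /disag natr_sum; apply: eq_bigr => j _; rewrite nthE.
  have := hmin h1 isT; rewrite -(ler_nat R) !disE.
  have -> : \sum_(j < q) (pr x w.1 (w.2 j) h1 != g (z x w.1 (w.2 j)))%:R = err w.
    by apply: eq_bigr => j _; rewrite pr1 eq_sym.
  move=> le1.
  have : dist w h <= err w +
      \sum_(j < q) (pr x w.1 (w.2 j) h != g (z x w.1 (w.2 j)))%:R.
    rewrite -big_split /=; apply: ler_sum => j _.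
    rewrite -natrD ler_nat.
    by case: (pr _ _ _ _) (g _) (F _) => [] [] [].
  lra.
have cardN : #|{: Om * {ffun 'I_q -> B}}|%:R = #|Om|%:R * #|B|%:R ^+ q :> R.
  by rewrite card_prod card_ffun card_ord natrM natrX.
have sum_bad : 10 * \sum_(w : Om * {ffun 'I_q -> B}) (w.1 \in bad)%:R <= #|{: Om * {ffun 'I_q -> B}}|%:R :> R.
  rewrite -(pair_big predT predT (fun a _ => (a \in bad)%:R)) /=.
  rewrite (eq_bigr (fun a => (a \in bad)%:R * #|B|%:R ^+ q)); last first.
    by move=> a _; rewrite sumr_const card_ffun card_ord -[LHS]mulr_natr natrX.
  rewrite -mulr_suml -natr_card mulrA cardN.
  by rewrite ler_pM2r ?exprn_gt0 // -natrM ler_nat.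
have qR0 : 0 < q%:R :> R by rewrite ltr0n.
have sum_err : 10 * \sum_w (err w * 100 / q%:R) <= #|{: Om * {ffun 'I_q -> B}}|%:R.
  have errj (j : 'I_q) :
      \sum_(w : Om * {ffun 'I_q -> B}) (g (z x w.1 (w.2 j)) != F (z x w.1 (w.2 j)))%:R <=
      #|{: Om * {ffun 'I_q -> B}}|%:R / 1000 :> R.
    rewrite -(pair_big predT predT
      (fun a (v : {ffun 'I_q -> B}) => (g (z x a (v j)) != F (z x a (v j)))%:R)) /=.
    rewrite -(ler_pM2l B0) mulr_sumr (eq_bigr (fun a =>
      #|B|%:R ^+ q * \sum_b (g (z x a b) != F (z x a b))%:R)); last first.
      move=> a _.
      exact: (sum_ffun_coord j (fun b => (g (z x a b) != F (z x a b))%:R)).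
    rewrite -mulr_sumr (pair_big predT predT
      (fun a b => (g (z x a b) != F (z x a b))%:R)) /=.
    rewrite cardN (mulrC #|Om|%:R) -!mulrA mulrCA ler_pM2l ?exprn_gt0 //.
    have := zunif x [pred y | g y != F y]; move/(congr1 (fun i => i%:R : R)).
    rewrite !natrM card_prod natrM natr_card /= => zu.
    have c0 : 0 < #|{: cube n}|%:R :> R.
      by rewrite ltr0n; apply/card_gt0P; exists [ffun=> false].
    rewrite -(ler_pM2r c0) zu.
    have := gclose; rewrite /Defs.close ler_pdivrMr // => h.
    have -> : #|B|%:R * (#|Om|%:R / 1000) * #|{: cube n}|%:R =
       (1 / 1000 * #|{: cube n}|%:R) * (#|Om|%:R * #|B|%:R) :> R by ring.
    by rewrite ler_pM2r // mulr_gt0 // ltr0n.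
  rewrite -mulr_suml -mulr_suml exchange_big /=.
  have : \sum_(j < q) \sum_(w : Om * {ffun 'I_q -> B}) (g (z x w.1 (w.2 j)) != F (z x w.1 (w.2 j)))%:R <=
      \sum_(j < q) (#|{: Om * {ffun 'I_q -> B}}|%:R / 1000) :> R by apply: ler_sum => j _.
  rewrite sumr_const card_ord -[X in _ <= X]mulr_natl => h.
  rewrite (mulrA 10) ler_pdivrMr //; lra.
(* A wrong hypothesis errs on a query with probability at least 1/20, so [e] has mean at most
   [1 - 1/40]. Over [q] queries the moment is at most [expR (q / 50 - q / 40)], which is the
   [expR (- (q / 200))] that pays for [#|H|]. *)
have sum_I3 : 10 * \sum_w I3 w <= #|{: Om * {ffun 'I_q -> B}}|%:R.
  have I3h a h : a \notin bad -> out x h != F x ->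
      \sum_(v : {ffun 'I_q -> B}) expR (q%:R / 50 - dist (a, v) h) <=
      #|B|%:R ^+ q * expR (- (q%:R / 200)).
    move=> abad outh; have [h1 [pr1 out1] far] := goodw _ abad.
    pose e b : R := expR (- (pr x a b h != F (z x a b))%:R).
    have sum_e : \sum_b e b <= #|B|%:R * expR (- (1 / 40)).
      apply: (@le_trans _ _ (\sum_b (1 - (pr x a b h != F (z x a b))%:R / 2))).
        apply: ler_sum => b _; rewrite /e; apply: expRN_le_half.
        by case: (_ != _); rewrite ?lexx ?ler01.
      rewrite sumrB sumr_const -mulr_suml.
      have := far h; rewrite out1 -(ler_nat R) natrM => /(_ outh).
      have -> : #|[pred b | pr x a b h != pr x a b h1]|%:R =
          \sum_b (pr x a b h != F (z x a b))%:R :> R.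
        by rewrite natr_card; apply: eq_bigr => b _; rewrite /= pr1.
      set d := \sum_b _ => h2'.
      have := le_expRN (1 / 40 : R); set r := expR _ => h1'.
      have : #|B|%:R * (1 - 1 / 40) <= #|B|%:R * r by rewrite ler_pM2l.
      lra.
    rewrite (eq_bigr (fun v : {ffun 'I_q -> B} => expR (q%:R / 50) * \prod_j e (v j))).
      rewrite -mulr_sumr -(bigA_distr_bigA (fun _ => e)) /= prodr_const card_ord.
      have -> : - (q%:R / 200) = q%:R / 50 - (q%:R * (1 / 40)) :> R by field.
      rewrite expRD mulrCA ler_pM2l ?expR_gt0 // -mulrN expRM_natl -exprMn.
      by rewrite lerXn2r ?nnegrE ?mulr_ge0 ?expR_ge0 // sumr_ge0 // => b _; exact: expR_ge0.
    by move=> v _; rewrite expRD -expR_sum sumrN.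
  rewrite /I3 -(pair_big predT predT (fun a v =>
    \sum_(h | (a \notin bad) && (out x h != F x)) expR (q%:R / 50 - dist (a, v) h))) /=.
  have I3a a : \sum_v \sum_(h | (a \notin bad) && (out x h != F x))
      expR (q%:R / 50 - dist (a, v) h) <= #|B|%:R ^+ q / 10.
    rewrite exchange_big /=.
    apply: (@le_trans _ _ (\sum_(h : H) #|B|%:R ^+ q * expR (- (q%:R / 200)))).
      rewrite [X in _ <= X](bigID (fun h => (a \notin bad) && (out x h != F x))) /=.
      rewrite -[X in X <= _]addr0; apply: lerD; last first.
        by apply: sumr_ge0 => h _; rewrite mulr_ge0 ?expR_ge0 ?exprn_ge0.
      by apply: ler_sum => h /andP[ab oh]; exact: I3h.
    rewrite sumr_const -[X in X <= _]mulr_natl mulrCA ler_pM2l ?exprn_gt0 //.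
    rewrite expRN ler_pdivrMr ?expR_gt0 //; lra.
  apply: (@le_trans _ _ (10 * \sum_(a : Om) (#|B|%:R ^+ q / 10))).
    by rewrite ler_pM2l //; apply: ler_sum => a _.
  rewrite sumr_const cardN -(mulr_natl (_ / _)); lra.
have : #|{: Om * {ffun 'I_q -> B}}|%:R <= \sum_w ((runw w == F x)%:R + (w.1 \in bad)%:R + err w * 100 / q%:R + I3 w).
  by rewrite -sumr_const; apply: ler_sum => w _; exact: pointwise.
rewrite !big_split /= => total.
change (2 / 3 <= \sum_(w : Om * {ffun 'I_q -> B} | runw w == F x) (#|{: Om * {ffun 'I_q -> B}}|%:R)^-1 :> R).
rewrite big_mkcond /= (eq_bigr (fun w => (runw w == F x)%:R / #|{: Om * {ffun 'I_q -> B}}|%:R)).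
  rewrite -mulr_suml ler_pdivlMr //; lra.
by move=> w _; case: (_ == _); rewrite ?mul1r ?mul0r.
Qed.

(** * Union bound and placements of the asymmetric variables *)

Lemma card_union_bound (R : realType) (I T : finType) (P : pred T) (Q : I -> pred T)
    (B : R) :
  (forall c, P c -> exists i, Q i c) -> (forall i, #|Q i|%:R <= B) ->
  #|P|%:R <= #|I|%:R * B.
Proof.
move=> PQ QB; rewrite natr_card.
apply: (@le_trans _ _ (\sum_i #|Q i|%:R)); last first.
  by rewrite mulr_natl -sumr_const; apply: ler_sum.
rewrite (eq_bigr (fun i => \sum_c (Q i c)%:R)) => [|i _]; last exact: natr_card.
rewrite exchange_big /=; apply: ler_sum => c _.
case: (boolP (P c)) => [/PQ[i Qi]|_]; last by apply: sumr_ge0.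
by rewrite (bigD1 i) //= Qi lerDl; apply: sumr_ge0.
Qed.

Definition ones n (x : cube n) : nat := #|[set i | x i]|.

Definition pull n k (h : 'I_k -> 'I_n) (x : cube n) : cube k := [ffun l => x (h l)].

(** Taking the total weight lets a hypothesis be evaluated from the query point. For a wrong row
    [u], [w - ones u] may be truncated or out of range, and [inord] then defaults to 0. *)
Definition core_at n k (c : core n k) (u : cube k) (w : nat) : bool :=
  c (u, inord (w - ones u)).

Definition asym n k (J : {set 'I_n}) (hJ : #|J| = k) (l : 'I_k) : 'I_n :=
  enum_val (cast_ord (esym hJ) l).

Lemma asym_inj n k (J : {set 'I_n}) (hJ : #|J| = k) : injective (asym hJ).
Proof. by move=> l l' /enum_val_inj /cast_ord_inj. Qed.

Lemma ones_pull n k (h : 'I_k -> 'I_n) (x : cube n) : injective h ->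
  ones (pull h x) = #|[set i in codom h | x i]|.
Proof.
move=> hI; rewrite /ones -(card_imset _ hI); apply: eq_card => i.
rewrite inE; apply/imsetP/andP => [[l]|[/codomP[l ->] xl]].
  by rewrite inE ffunE => xl ->; rewrite codom_f.
by exists l; rewrite // inE ffunE.
Qed.

(** Permuting preserves the total weight, so [s] matters only through the places of the [k]
    asymmetric variables. *)
Lemma permute_of_core n k (J : {set 'I_n}) (hJ : #|J| = k) (c : core n k)
    (s : 'S_n) (x : cube n) :
  permute (of_core hJ c) s x = core_at c (pull (s \o asym hJ) x) (ones x).
Proof.
rewrite /permute /of_core /core_at; set y : cube n := [ffun i => x (s i)].
have eu : restrict hJ y = pull (s \o asym hJ) x by apply/ffunP => l; rewrite !ffunE.
congr (c (_, _)) => //; apply/val_inj => /=.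
have oy : ones y = ones x.
  rewrite /ones -[RHS](card_preimset _ (@perm_inj _ s)).
  by apply: eq_card => i; rewrite !inE ffunE.
rewrite -eu -oy.
have -> : ones (restrict hJ y) = #|[set i | y i] :&: J|.
  rewrite (ones_pull _ (@asym_inj _ _ _ hJ)); apply: eq_card => i; rewrite !inE andbC.
  congr (_ && _); apply/codomP/idP => [[l ->]|iJ]; first exact: enum_valP.
  exists (cast_ord hJ (enum_rank_in iJ i)).
  by rewrite /asym cast_ordK enum_rankK_in.
have wE : weight_out J y = (ones y - #|[set i | y i] :&: J|)%N.
  rewrite /ones -(cardsID J [set i | y i]) addKn; apply: eq_card => i.
  by rewrite !inE.
by rewrite -wE inordK // weight_out_lt.
Qed.

(** Translation by a mask supported on the image of [h] carries any fibre of [pull h] onto any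
    other, so the [2 ^ k] fibres have equal size. *)
Lemma card_pull n k (h : 'I_k -> 'I_n) (u : cube k) : injective h ->
  (#|[pred x : cube n | pull h x == u]| * 2 ^ k = 2 ^ n)%N.
Proof.
move=> hI; pose m (v : cube k) : cube n :=
  [ffun i => [exists l, (h l == i) && v l]].
have mE v l : m v (h l) = v l.
  rewrite ffunE; apply/existsP/idP => [[l' /andP[/eqP /hI ->]]//|vl].
  by exists l; rewrite eqxx.
have fibre v : #|[pred x : cube n | pull h x == v]| = #|[pred x : cube n | pull h x == u]|.
  pose w : cube k := [ffun l => u l (+) v l].
  pose T (x : cube n) : cube n := [ffun i => x i (+) m w i].
  have TK : involutive T.
    by move=> x; apply/ffunP => i; rewrite !ffunE -addbA addbb addbF.
  rewrite -!sum1_card [RHS](reindex_inj (inv_inj TK)); apply: eq_bigl => x.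
  have pT l : pull h (T x) l = pull h x l (+) (u l (+) v l).
    by rewrite !ffunE; have := mE w l; rewrite !ffunE => ->.
  rewrite !inE; apply/eqP/eqP => e; apply/ffunP => l.
    by rewrite pT e addbCA addbb addbF.
  by apply: (can_inj (addbK (u l (+) v l))); rewrite -pT e addbCA addbb addbF.
have : #|{: cube n}| = (2 ^ n)%N by rewrite card_ffun card_bool card_ord.
move=> <-; rewrite -[in RHS]sum1_card (partition_big (pull h) predT) //=.
rewrite (eq_bigr (fun=> #|[pred x : cube n | pull h x == u]|)) => [|v _].
  by rewrite sum_nat_const card_ffun card_bool card_ord mulnC.
by rewrite -(fibre v) -sum1_card; apply: eq_bigl => x; rewrite !inE.
Qed.

(** * Large [k]: independent uniform queries *)

(** The union runs over pairs of the true placement, which is injective, and a rival one; a pair is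
    bad if it disagrees on less than 1/20 of the cube. *)
Lemma few_bad_cores_uniform (R : realType) n k (J : {set 'I_n}) (hJ : #|J| = k)
    (q : nat) : (0 < n)%N ->
  10 * (n ^ k)%:R <= expR (q%:R / 200) :> R ->
  #|[pred c : core n k | ~~ `[< nonadaptively_locally_correctable (of_core hJ c) q
      (1 / 1000 : R) >]]|%:R <=
  (n ^ k * n ^ k)%:R * (#|{: core n k}|%:R * expR (- ((2 ^ k)%:R / 80))) :> R.
Proof.
move=> n0 Hq.
pose dis (c : core n k) (h1 h2 : {ffun 'I_k -> 'I_n}) (b : cube n) :=
  core_at c (pull h1 b) (ones b) != core_at c (pull h2 b) (ones b).
pose bad (p : {ffun 'I_k -> 'I_n} * {ffun 'I_k -> 'I_n}) (c : core n k) :=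
  [&& injectiveb p.1, p.1 != p.2 & (20 * #|dis c p.1 p.2| < 2 ^ n)%N].
have -> : (n ^ k * n ^ k = #|{: {ffun 'I_k -> 'I_n} * {ffun 'I_k -> 'I_n}}|)%N.
  by rewrite card_prod !card_ffun !card_ord.
apply: (card_union_bound (Q := bad)) => [c|[h1 h2]].
  move=> ncorr; apply/existsP; apply: contraNT ncorr => /existsPn good.
  apply/asboolP.
  pose h0 : {ffun 'I_k -> 'I_n} := [ffun=> Ordinal n0].
  apply: (@correctable_of_hypotheses R n _ unit (cube n) {ffun 'I_k -> 'I_n} h0
    [ffun=> false] (fun _ _ b => b) (fun _ _ b h => core_at c (pull h b) (ones b))
    (fun x h => core_at c (pull h x) (ones x))).
  - by rewrite card_unit.
  - by rewrite card_ffun !card_ord.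
  - move=> x P; rewrite card_prod card_unit mul1n; congr (_ * _)%N.
    rewrite -(card_image (f := fun b : cube n => (tt, b))) => [|b b' []//].
    apply: eq_card => -[[] b]; rewrite [LHS]inE /=. apply/idP/fintype.imageP => [Pb|[b' Pb' [->]]//].
    by exists b.
  move=> s x; exists finset.set0 => [|[] _]; first by rewrite cards0.
  pose h : {ffun 'I_k -> 'I_n} := [ffun l => s (asym hJ l)].
  have hE y : pull h y = pull (s \o asym hJ) y by apply/ffunP => l; rewrite !ffunE.
  exists h; first by split=> [b|]; rewrite permute_of_core hE.
  move=> h' outh'; have hh' : h != h' by apply: contraNneq outh' => ->.
  have hI : injectiveb h.
    apply/injectiveP => l l'; rewrite !ffunE => /perm_inj; exact: asym_inj.
  have := good (h, h'); rewrite /bad hI hh' /= -leqNgt.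
  rewrite card_ffun card_bool card_ord => /leq_trans; apply; rewrite leq_mul2l /=.
  by apply: subset_leq_card; apply/fintype.subsetP => b; rewrite !inE /dis unfold_in eq_sym.
have rhs0 : 0 <= #|{: core n k}|%:R * expR (- ((2 ^ k)%:R / 80)) :> R.
  by rewrite mulr_ge0 ?expR_ge0.
have [hI|hI] := boolP (injectiveb h1); last first.
  by rewrite eq_card0 // => c; rewrite unfold_in /bad /= (negbTE hI).
have [hh|hh] := eqVneq h1 h2.
  by rewrite eq_card0 // => c; rewrite unfold_in /bad /= hh eqxx andbF.
have [l hl] : exists l, h1 l != h2 l.
  apply/existsP; apply: contraNT hh => /existsPn e; apply/eqP/ffunP => l.
  by have := e l; rewrite negbK => /eqP.
(* On the quarter [E0] of the cube with value 1 at [h1 l] and 0 at [h2 l], the two predicted rows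
   differ in bit [l], so [A] separates them. *)
pose w : cube 2 := [ffun i => i == ord0].
pose hp (i : 'I_2) : 'I_n := if i == ord0 then h1 l else h2 l.
have hpI : injective hp.
  move=> i j; rewrite /hp; case: eqVneq => [->|i0]; case: eqVneq => [->|j0] // e.
  - by rewrite e eqxx in hl.
  - by rewrite e eqxx in hl.
  - by apply/val_inj; case: i j i0 j0 {e} => [[|[|?]] ?] [[|[|?]] ?].
pose E0 : {set cube n} := [set b | pull hp b == w].
have E0P b : b \in E0 -> b (h1 l) /\ ~~ b (h2 l).
  rewrite inE => /eqP /ffunP e.
  by have := e ord0; have := e ord_max; rewrite !ffunE /hp /= => -> ->.
have E0card : (#|E0| * 4 = 2 ^ n)%N by rewrite -(card_pull w hpI) cardsE.
pose A : {set cube k * 'I_(n - k).+1} :=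
  [set p : cube k * 'I_(n - k).+1 | p.1 l].
pose phi (h : {ffun 'I_k -> 'I_n}) (b : cube n) : cube k * 'I_(n - k).+1 :=
  (pull h b, inord (ones b - ones (pull h b))).
have k2 : 0 < (2 ^ k)%:R :> R by rewrite ltr0n expn_gt0.
have n2 : 0 < (2 ^ n)%:R :> R by rewrite ltr0n expn_gt0.
have := @card_few_disagreements R _ _ (phi h1) (phi h2) A E0
  ((2 ^ n)%:R / (2 ^ k)%:R) ((2 ^ n)%:R / 20) _ _ _.
(* The fibres have at most [2 ^ n / 2 ^ k] points, so the exponent is [(1/20 - 1/16) * 2 ^ k]. *)
have -> : ((2 ^ n)%:R / 20 - #|E0|%:R / 4) / ((2 ^ n)%:R / (2 ^ k)%:R) =
    - ((2 ^ k)%:R / 80) :> R.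
  have -> : #|E0|%:R = (2 ^ n)%:R / 4 :> R.
    by rewrite -E0card natrM mulfK ?pnatr_eq0.
  by field; rewrite !gt_eqF.
move=> cut; apply: le_trans (cut _ _ _).
- rewrite ler_nat; apply: subset_leq_card; apply/fintype.subsetP => c.
  rewrite unfold_in => /and3P[_ _ lt]; rewrite inE.
  rewrite ler_pdivlMr // -natrM ler_nat mulnC; apply: leq_trans (ltnW lt).
  rewrite leq_mul2l /=; apply: subset_leq_card; apply/fintype.subsetP => b.
  by rewrite inE => /andP[].
- by move=> b /E0P[b1 b2]; rewrite !inE !ffunE.
- by rewrite divr_gt0.
- move=> [u v]; rewrite ler_pdivlMr // -natrM ler_nat -(card_pull u (injectiveP _ hI)).
  rewrite leq_mul2r; apply/orP; right; apply: subset_leq_card; apply/fintype.subsetP => b.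
  by rewrite !inE => /andP[_ /eqP[-> _]].
Qed.

(** * Anticoncentration of binomial weights *)

Lemma bin_double_le d r : ('C(d.*2, r) <= 'C(d.*2, d))%N.
Proof.
have half i : ('C(d.*2, d - i) <= 'C(d.*2, d))%N.
  elim: i => [|i IH]; first by rewrite subn0.
  have [ltid|ledi] := ltnP i d; last by have -> : (d - i.+1 = d - i)%N by lia.
  apply: leq_trans IH; have := mul_bin_left d.*2 (d - i.+1).
  have -> : (d - i.+1).+1 = (d - i)%N by lia.
  have : (0 < d - i <= d.*2 - (d - i.+1))%N by lia.
  set a := (d - i)%N; set b := (d.*2 - _)%N => /andP[a0 ab] e.
  by rewrite -(leq_pmul2l a0) e leq_mul2r ab orbT.
have [ler|ltr] := leqP r d; first by have := half (d - r)%N; rewrite subKn.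
have [le2|lt2] := leqP r d.*2; last by rewrite bin_small.
by rewrite -bin_sub //; have := half (r - d)%N; have -> : (d - (r - d) = d.*2 - r)%N by lia.
Qed.

(** The bound [4 ^ d / sqrt (2 * d + 1)], squared to stay in the naturals. The induction step rests
    on [(2 * d + 1) * (2 * d + 3) <= 4 * (d + 1) ^ 2]. *)
Lemma bin_double_mid d : ('C(d.*2, d) ^ 2 * d.*2.+1 <= 16 ^ d)%N.
Proof.
elim: d => // d IH.
have e : (d.+1 * 'C(d.+1.*2, d.+1) = 2 * d.*2.+1 * 'C(d.*2, d))%N.
  have e1 := mul_bin_diag d.*2.+2 d; have e2 := mul_bin_down d.*2.+1 d.
  rewrite doubleS -e1 -mulnA e2 /=.
  have -> : (d.*2.+1 - d = d.+1)%N by lia.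
  by rewrite mulnA; congr (_ * _)%N; lia.
rewrite -(@leq_pmul2l (d.+1 ^ 2)) ?expn_gt0 // mulnA -expnMn e.
rewrite [X in (_ <= X)%N]mulnC.
move: IH; set c := 'C(_, _); set p := (16 ^ d)%N => IH.
apply: (@leq_trans (4 * (d.*2.+1 * d.+1.*2.+1) * (c ^ 2 * d.*2.+1))); first nia.
apply: (@leq_trans (4 * (d.*2.+1 * d.+1.*2.+1) * p)); first by rewrite leq_mul2l IH orbT.
have h : (d.*2.+1 * d.+1.*2.+1 <= 4 * d.+1 ^ 2)%N by nia.
apply: (@leq_trans (4 * (4 * d.+1 ^ 2) * p)); first by rewrite leq_mul2r leq_mul2l h !orbT.
apply: eq_leq; rewrite [(16 ^ _)%N]expnS -/p; ring.
Qed.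

Lemma card_setI_eq (T : finType) (W : {set T}) (r : nat) :
  (#|[pred v : {set T} | #|v :&: W| == r]| <= 'C(#|W|, r) * 2 ^ (#|T| - #|W|))%N.
Proof.
rewrite -cards_draws.
have -> : (#|T| - #|W|)%N = #|~: W| by rewrite [RHS]cardsCs finset.setCK.
rewrite -card_powerset -cardsX.
pose f (v : {set T}) := (v :&: W, v :&: ~: W).
have fI : injective f by move=> v v' [e1 e2]; rewrite -(finset.setID v W) finset.setDE e1 e2 -finset.setDE finset.setID.
rewrite -(card_image fI); apply: subset_leq_card; apply/fintype.subsetP => p.
move=> /fintype.imageP[v vr ->]; move: vr; rewrite !inE /= => ->.
by rewrite !finset.subsetIr.
Qed.

(** No weight on [W] is more likely than the middle one; this bounds the fibres over the columns of
    the core. *)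
Lemma card_setI_eq_le (R : realType) (T : finType) (W : {set T}) (d r : nat) :
  #|W| = d.*2 ->
  #|[pred v : {set T} | #|v :&: W| == r]|%:R <=
    (2 ^ #|T|)%:R / Num.sqrt (d.*2.+1)%:R :> R.
Proof.
move=> Wd; have le := card_setI_eq W r.
have WT : (d.*2 <= #|T|)%N by rewrite -Wd max_card.
have s0 : 0 < Num.sqrt (d.*2.+1)%:R :> R by rewrite sqrtr_gt0 ltr0n.
rewrite ler_pdivlMr //.
apply: (@le_trans _ _ (('C(#|W|, r) * 2 ^ (#|T| - #|W|))%:R * Num.sqrt (d.*2.+1)%:R)).
  by rewrite ler_pM2r // ler_nat.
rewrite Wd -[in X in _ <= X](subnK WT) expnD !natrM mulrAC [X in _ <= X]mulrC.
rewrite ler_pM2r ?ltr0n ?expn_gt0 //.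
rewrite -(@ler_pXn2r _ 2) ?nnegrE ?mulr_ge0 ?sqrtr_ge0 //.
rewrite exprMn sqr_sqrtr // -!natrX -natrM ler_nat.
apply: (@leq_trans ('C(d.*2, d) ^ 2 * d.*2.+1)).
  by rewrite leq_mul2r leq_exp2r // bin_double_le orbT.
apply: leq_trans (bin_double_mid d) _.
by rewrite -[16%N]/(2 ^ 4)%N -!expnM leq_exp2l //; lia.
Qed.

(** * Blocks of variables and separation of rows *)

Definition block n m (t : nat) : {set 'I_n} := [set i : 'I_n | (i %/ m)%N == t].

Lemma card_block n m t : (0 < m)%N -> (t.+1 * m <= n)%N -> #|block n m t| = m.
Proof.
move=> m0 tmn.
have lt (j : 'I_m) : (t * m + j < n)%N by have := ltn_ord j; lia.
pose f j := Ordinal (lt j).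
have fI : injective f by move=> i j /(congr1 val) /= /addnI /val_inj.
rewrite -[RHS]card_ord -cardsT -(card_imset _ fI); apply: eq_card => i.
rewrite inE; apply/eqP/imsetP => [e|[j _ ->]]; last first.
  by rewrite /= divnMDl // divn_small ?addn0.
exists (Ordinal (ltn_pmod i m0)); first by rewrite inE.
by apply/val_inj; rewrite /= -e -divn_eq.
Qed.

(** Each variable lies in at most one block, so one of [10 * k] blocks drawn at random meets the
    asymmetric variables with probability at most 1/10, as decoding allows. *)
Lemma card_hit_blocks n m T k (h : 'I_k -> 'I_n) :
  (#|[set t : 'I_T | [exists l, h l \in block n m t]]| <= k)%N.
Proof.
have [->|/card_gt0P[t0 _]] := posnP #|[set t : 'I_T | [exists l, h l \in block n m t]]| => //.
pose g l := insubd t0 (h l %/ m)%N.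
apply: leq_trans (_ : #|codom g| <= k)%N; last first.
  by rewrite -[X in (_ <= X)%N](card_ord k); exact: leq_image_card.
apply: subset_leq_card; apply/fintype.subsetP => t; rewrite !inE => /existsP[l].
rewrite inE => /eqP e; apply/codomP; exists l; apply/val_inj.
by rewrite /g e insubdK // unfold_in ltn_ord.
Qed.

(* Only the row of [u] is required to stay in range: the row of [u'] comes from
   a possibly inconsistent hypothesis, for which [core_at] truncates the weight. *)
Lemma card_inseparable_rows (R : realType) n k (W : {set 'I_n}) d (u u' : cube k) h0 :
  #|W| = d.*2 -> u != u' -> (ones u <= h0)%N -> (h0 + d.*2 <= n - k + ones u)%N ->
  #|[pred c : core n k | (10 * #|[pred v : {set 'I_n} |
      core_at c u (h0 + #|v :&: W|) != core_at c u' (h0 + #|v :&: W|)]| < 2 ^ n)%N]|%:R <=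
  #|{: core n k}|%:R * expR (- (3 / 20 * Num.sqrt (d.*2.+1)%:R)) :> R.
Proof.
move=> cW uu' uh hn.
pose phi (w : cube k) (v : {set 'I_n}) : cube k * 'I_(n - k).+1 :=
  (w, inord (h0 + #|v :&: W| - ones w)).
have s0 : 0 < Num.sqrt (d.*2.+1)%:R :> R by rewrite sqrtr_gt0 ltr0n.
have n2 : 0 < (2 ^ n)%:R :> R by rewrite ltr0n expn_gt0.
have := @card_few_disagreements R _ _ (phi u) (phi u') [set p | p.1 == u] [set: {set 'I_n}]
  ((2 ^ n)%:R / Num.sqrt (d.*2.+1)%:R) ((2 ^ n)%:R / 10).
have -> : #|[set: {set 'I_n}]| = (2 ^ n)%N by rewrite -powersetT card_powerset cardsT card_ord.
have -> : ((2 ^ n)%:R / 10 - (2 ^ n)%:R / 4) / ((2 ^ n)%:R / Num.sqrt (d.*2.+1)%:R) =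
    - (3 / 20 * Num.sqrt (d.*2.+1)%:R) :> R.
  by field; rewrite !gt_eqF.
move=> cut; apply: le_trans (cut _ _ _).
- rewrite ler_nat; apply: subset_leq_card; apply/fintype.subsetP => c.
  rewrite !inE => lt; rewrite ler_pdivlMr // -natrM ler_nat mulnC.
  apply: leq_trans (ltnW lt); rewrite leq_mul2l /=; apply: subset_leq_card.
  by apply/fintype.subsetP => v; rewrite !inE => /andP[].
- by move=> v _; rewrite !inE /= eqxx eq_sym.
- by rewrite divr_gt0.
move=> a; set S := [pred v in _ | _].
have [->|/card_gt0P[v0]] := posnP #|S|; first by rewrite divr_ge0 // ltW.
rewrite !inE /= => /eqP e0.
have le v : (#|v :&: W| <= d.*2)%N by rewrite -cW subset_leq_card // finset.subsetIr.
rewrite -[n in X in _ <= X]card_ord.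
apply: le_trans (card_setI_eq_le R #|v0 :&: W| cW); rewrite ler_nat.
apply: subset_leq_card; apply/fintype.subsetP => v; rewrite !inE /= -e0 => /eqP[].
(* The two bounds on [h0] exclude truncation and overflow, so equal columns give equal
   [#|v :&: W|]. *)
have lt w : (h0 + #|w :&: W| - ones u < (n - k).+1)%N by have := le w; lia.
by move=> /(congr1 val) /=; rewrite !inordK // => e; apply/eqP; lia.
Qed.

(** * Small [k]: masked queries with a random block *)

(* A uniform mask [w.2] makes every single query uniform, whatever [x] and [p]. *)
Definition block_query n m T (x : cube n) (w : 'I_T * cube n)
    (p : {ffun bool -> bool} * {set 'I_n}) : cube n :=
  [ffun i => w.2 i (+) (if i \in block n m w.1 then i \in p.2 else p.1 (x i))].

(** The query is the mask plus a shift independent of the mask, so exchanging mask and query point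
    is an involution. *)
Lemma block_query_uniform n m T (x : cube n) (P : pred (cube n)) :
  (#|[pred p : ('I_T * cube n) * ({ffun bool -> bool} * {set 'I_n}) |
      P (block_query m x p.1 p.2)]| * #|{: cube n}| =
   #|P| * #|{: ('I_T * cube n) * ({ffun bool -> bool} * {set 'I_n})}|)%N.
Proof.
pose F (p : ('I_T * cube n) * ({ffun bool -> bool} * {set 'I_n})) :=
  ((p.1.1, block_query m x p.1 p.2), p.2).
have FK : involutive F.
  move=> [[t s] p]; rewrite /F /block_query /=; do 2 f_equal.
  by apply/ffunP => i; rewrite !ffunE /= -addbA addbb addbF.
rewrite -sum1_card (reindex_inj (inv_inj FK)) /=.
rewrite (eq_bigl (mem [predX [predX xpredT & P] & xpredT])) => [|[[t s] p]]; last first.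
  rewrite !inE /= andbT; congr (P _).
  by have := FK ((t, s), p); rewrite {1}/F /= => -[].
rewrite sum1_card !cardX !card_prod.
rewrite (_ : #|xpredT| = T) ?card_ord //.
rewrite /cube; ring.
Qed.

Lemma ones_block_query n m T (x : cube n) (t : 'I_T) (s : cube n)
    (b : {ffun bool -> bool}) (v : {set 'I_n}) :
  ones (block_query m x (t, s) (b, v)) =
  (#|[set i in ~: block n m t | s i (+) b (x i)]| +
   #|[set i | s i (+) (i \in v)] :&: block n m t|)%N.
Proof.
rewrite /ones -(cardsID (block n m t) [set i | block_query m x (t, s) (b, v) i]) addnC; congr (_ + _)%N; apply: eq_card => i.
  by rewrite !inE ffunE !inE /=; case: (_ == _).
by rewrite !inE ffunE !inE /=; case: (_ == _); rewrite ?andbF.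
Qed.

(** Flipping [b] at [y l] changes only one side, so it exchanges the event with its complement among
    the four maps [b]. *)
Lemma card_row_differs k (y y' s s' : cube k) l : y l != y' l ->
  #|[pred b : {ffun bool -> bool} | s l (+) b (y l) != s' l (+) b (y' l)]| = 2%N.
Proof.
move=> yy; set G := [pred b | _].
pose F (b : {ffun bool -> bool}) : {ffun bool -> bool} := [ffun e => b e (+) (e == y l)].
have FK : involutive F.
  by move=> b; apply/ffunP => e; rewrite !ffunE -addbA addbb addbF.
have cC : #|[predC G]| = #|G|.
  rewrite -!sum1_card [RHS](reindex_inj (inv_inj FK)) /=; apply: eq_bigl => b.
  rewrite !inE !ffunE eqxx [y' l == _]eq_sym (negbTE yy) addbF.
  by case: (s l) (b (y l)) (s' l) (b (y' l)) => [] [] [] [].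
by have := cardC G; rewrite cC card_ffun card_bool addnn => /(congr1 half); rewrite doubleK => ->.
Qed.

(** The union runs over the block, two rows, and the weight [h0] of the query outside the block;
    given these, only the random set [v] matters. *)
Lemma few_bad_cores_block (R : realType) n k (J : {set 'I_n}) (hJ : #|J| = k)
    (d q : nat) : (0 < k)%N -> (0 < d)%N -> (10 * k * d.*2 <= n)%N ->
  10 * (4 ^ k)%:R <= expR (q%:R / 200) :> R ->
  #|[pred c : core n k | ~~ `[< nonadaptively_locally_correctable (of_core hJ c) q
      (1 / 1000 : R) >]]|%:R <=
  (10 * k * (2 ^ k * 2 ^ k) * n.+1)%:R *
    (#|{: core n k}|%:R * expR (- (3 / 20 * Num.sqrt (d.*2.+1)%:R))) :> R.
Proof.
move=> k0 d0 kdn Hq; pose T := (10 * k)%N; pose m := d.*2.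
have cW (t : 'I_T) : #|block n m t| = d.*2.
  apply: card_block; rewrite /m; first by lia.
  by apply: leq_trans kdn; rewrite leq_mul2r ltn_ord orbT.
pose bad (p : 'I_T * (cube k * cube k) * 'I_n.+1) (c : core n k) :=
  [&& p.1.2.1 != p.1.2.2, (ones p.1.2.1 <= p.2)%N,
      (p.2 + d.*2 <= n - k + ones p.1.2.1)%N &
    (10 * #|[pred v : {set 'I_n} |
      core_at c p.1.2.1 (p.2 + #|v :&: block n m p.1.1|) !=
      core_at c p.1.2.2 (p.2 + #|v :&: block n m p.1.1|)]| < 2 ^ n)%N].
have -> : (10 * k * (2 ^ k * 2 ^ k) * n.+1 =
    #|{: 'I_T * (cube k * cube k) * 'I_n.+1}|)%N.
  by rewrite !card_prod !card_ffun !card_ord card_bool.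
apply: (card_union_bound (Q := bad)) => [c|[[t [u u']] h0]]; last first.
  have [uu|uu] := eqVneq u u'.
    by rewrite eq_card0 ?mulr_ge0 ?expR_ge0 // => c; rewrite unfold_in /bad /= uu eqxx.
  have [c1|c1] := leqP (ones u) h0; last first.
    rewrite eq_card0 ?mulr_ge0 ?expR_ge0 // => c.
    by rewrite unfold_in /bad /= leqNgt c1 /= andbF.
  have [c2|c2] := leqP (h0 + d.*2) (n - k + ones u); last first.
    rewrite eq_card0 ?mulr_ge0 ?expR_ge0 // => c.
    by rewrite unfold_in /bad /= (leqNgt (_ + _)) c2 /= !andbF.
  apply: le_trans (card_inseparable_rows R (cW t) uu c1 c2).
  rewrite ler_nat; apply: subset_leq_card; apply/fintype.subsetP => c.
  by rewrite unfold_in inE => /and4P[].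
move=> ncorr; apply/existsP; apply: contraNT ncorr => /existsPn good.
apply/asboolP.
pose z0 : cube k := [ffun=> false].
apply: (@correctable_of_hypotheses R n _ _ _ (cube k * cube k)%type (z0, z0)
  ([ffun=> false], finset.set0) (@block_query n m T)
  (fun x w p h => core_at c [ffun l => h.2 l (+) p.1 (h.1 l)] (ones (block_query m x w p)))
  (fun x h => core_at c h.1 (ones x))).
- by rewrite card_prod card_ord card_ffun card_bool card_ord muln_gt0 expn_gt0 /T; lia.
- by rewrite card_prod !card_ffun card_bool card_ord -expnMn.
- by move=> x P; exact: block_query_uniform.
move=> s x; pose h : 'I_k -> 'I_n := s \o asym hJ.
have hI : injective h by move=> l l' /perm_inj; exact: asym_inj.
exists [set w : 'I_T * cube n | [exists l, h l \in block n m w.1]].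
  have -> : [set w : 'I_T * cube n | [exists l, h l \in block n m w.1]] =
      finset.setX [set t : 'I_T | [exists l, h l \in block n m t]] [set: cube n].
    by apply/finset.setP => w; rewrite !inE andbT.
  rewrite cardsX cardsT card_prod card_ord mulnA leq_mul2r.
  by rewrite /T leq_mul2l card_hit_blocks !orbT.
move=> [t w]; rewrite inE /= => /existsPn hW.
exists (pull h x, pull h w) => /=.
  split=> [[b v]|]; rewrite permute_of_core //; congr (core_at c _ _).
  by apply/ffunP => l; rewrite !ffunE /= (negbTE (hW l)).
move=> [y w'] /= outy.
have [l yl] : exists l, pull h x l != y l.
  apply/existsP; apply: contraNT outy => /existsPn e.
  have -> : y = pull h x by apply/ffunP => l; have := e l; rewrite negbK => /eqP.
  by rewrite eqxx.
pose row (p : cube k * cube k) (b : {ffun bool -> bool}) : cube k :=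
  [ffun l => p.2 l (+) b (p.1 l)].
pose dis (b : {ffun bool -> bool}) (v : {set 'I_n}) :=
  core_at c (row (y, w') b) (ones (block_query m x (t, w) (b, v))) !=
  core_at c (row (pull h x, pull h w) b) (ones (block_query m x (t, w) (b, v))).
pose G := [pred b : {ffun bool -> bool} |
  pull h w l (+) b (pull h x l) != w' l (+) b (y l)].
(* Half of the [b] put the two hypotheses on different rows, and there a tenth of the [v] tell them
   apart: 1/20 in all. *)
have sep b : b \in G -> (2 ^ n <= 10 * #|dis b|)%N.
  rewrite inE => bG; set W := block n m t.
  set u := row (pull h x, pull h w) b; set u' := row (y, w') b.
  have uu : u != u'.
    by apply: contraNneq bG => /ffunP /(_ l); rewrite !ffunE /= => ->.
  pose z' : cube n := [ffun i => w i (+) b (x i)].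
  have uE : u = pull h z' by apply/ffunP => e; rewrite !ffunE.
  pose C := [set i in codom h].
  have CW : C \subset ~: W.
    by apply/fintype.subsetP => i; rewrite inE => /codomP[e ->]; rewrite inE hW.
  pose h0 := #|[set i in ~: W | w i (+) b (x i)]|.
  have h0n : (h0 < n.+1)%N by rewrite ltnS -[X in (_ <= X)%N]card_ord max_card.
  have uC : ones u = #|[set i | z' i] :&: C|.
    by rewrite uE ones_pull //; apply: eq_card => i; rewrite !inE andbC.
  have c1 : (ones u <= h0)%N.
    rewrite uC; apply: subset_leq_card; apply/fintype.subsetP => i.
    by rewrite 2!inE ffunE => /andP[zi /(fintype.subsetP CW)]; rewrite !inE zi andbT.
  (* Of the [n - d.*2] variables outside [W], the [k] asymmetric ones contribute [ones u], the
     others at most [n - d.*2 - k]. *)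
  have c2 : (h0 + d.*2 <= n - k + ones u)%N.
    have cC : #|C| = k by rewrite cardsE card_codom // card_ord.
    have cWn : (#|W| + #|~: W| = n)%N by rewrite cardsC card_ord.
    have leC : (k <= #|~: W|)%N by rewrite -cC subset_leq_card.
    have : (h0 <= ones u + #|~: W :\: C|)%N.
      rewrite uC; apply: leq_trans (leq_card_setU _ _); apply: subset_leq_card.
      apply/fintype.subsetP => i; rewrite !inE ffunE => /andP[iW zi].
      by rewrite zi iW /= andbT; case: (i \in codom h).
    rewrite cardsDS // cC; rewrite cW in cWn; lia.
  have := good (t, (u, u'), Ordinal h0n).
  rewrite /bad /= uu c1 c2 /= -leqNgt => /leq_trans; apply; rewrite leq_mul2l /=.
  (* Adding the mask permutes the sets [v], so the weight inside the block can be read as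
     [#|v :&: W|]. *)
  pose F (v : {set 'I_n}) : {set 'I_n} := [set i | w i (+) (i \in v)].
  have FK : involutive F.
    by move=> v; apply/finset.setP => i; rewrite !inE addbA addbb.
  apply: eq_leq; rewrite -!sum1_card (reindex_inj (inv_inj FK)) /=.
  apply: eq_bigl => v; rewrite !inE /dis [RHS]unfold_in eq_sym /dis.
  by rewrite !ones_block_query.
have -> : #|[pred p : {ffun bool -> bool} * {set 'I_n} | dis p.1 p.2]| = (\sum_b #|dis b|)%N.
  rewrite -sum1_card (eq_bigl (fun p => xpredT p.1 && dis p.1 p.2)) //.
  rewrite -(pair_big_dep xpredT dis (fun _ _ => 1%N)) /=.
  by apply: eq_bigr => b _; rewrite sum1_card.
rewrite (bigID (mem G)) /= mulnDr; apply: leq_trans (leq_addr _ _).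
rewrite card_prod -[X in (_ * X)%N](_ : (2 ^ n)%N = _); last first.
  by rewrite -[RHS]cardsT -powersetT card_powerset cardsT card_ord.
rewrite card_ffun card_bool big_distrr /=.
apply: (@leq_trans (\sum_(b in G) 2 * 2 ^ n)%N).
  by rewrite sum_nat_const card_row_differs // mulnA.
by apply: leq_sum => b /sep; lia.
Qed.

(** * Numerical bounds and choice of the regime *)

(** Here 1920 is [24 * 80]: a union bound of [2 ^ (24 * k ^ 2)] is set against
    [expR (2 ^ k / 80)]. *)
Lemma sqr_le_pow2 k : (100 <= k)%N -> (1920 * k ^ 2 <= 2 ^ k)%N.
Proof.
move=> /subnK <-; elim: (k - 100)%N => [|i IH].
  rewrite add0n -[100%N]/(5 * 20)%N expnM.
  apply: (@leq_trans ((2 ^ 5) ^ 5)%N); last by rewrite leq_exp2l.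
  by rewrite -!mulnn !expnS; lia.
rewrite addSn [X in (_ <= X)%N]expnS; apply: leq_trans (_ : 2 * (1920 * (i + 100) ^ 2) <= _)%N.
  by rewrite -!mulnn; nia.
by rewrite leq_mul2l.
Qed.

Lemma pow2_le_expR (R : realType) (m : nat) (x : R) : m%:R <= x -> (2 ^ m)%:R <= expR x.
Proof.
rewrite -ler_expR; apply: le_trans.
rewrite -[m%:R]mulr1 expRM_natl natrX lerXn2r ?nnegrE ?expR_ge0 //.
by have := expR_ge1Dx (1 : R); lra.
Qed.

Lemma ln_ge_half (R : realType) k : (2 <= k)%N -> 1 / 2 <= ln (k%:R : R).
Proof.
move=> k2; have k0 : 0 < k%:R :> R by rewrite ltr0n; lia.
rewrite -ler_expR lnK ?posrE //.
apply: (@le_trans _ _ 2); last by rewrite ler_nat.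
have := le_expRN (1 / 2 : R); rewrite expRN.
have e0 := expR_gt0 (1 / 2 : R).
rewrite -[X in _ <= X]mul1r ler_pdivlMr //; lra.
Qed.

(** [a] is the integer part of the eighth root of [n]. Since [d >= a ^ 6], the moment is at most
    [expR (- (3 / 20 * a ^ 3))], while the union bound and the factor [n.+1] cost at most
    [2 ^ (20 * a)]. *)
Lemma few_bad_cores_small (R : realType) n k a (J : {set 'I_n}) (hJ : #|J| = k) :
  (100 <= a)%N -> (a ^ 8 <= n)%N -> (n.+1 <= a.+1 ^ 8)%N -> (2 <= k <= a)%N ->
  #|[pred c : core n k | ~~ `[< nonadaptively_locally_correctable (of_core hJ c)
      (800 * k) (1 / 1000 : R) >]]|%:R <= #|{: core n k}|%:R / n.+1%:R :> R.
Proof.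
move=> a100 an na /andP[k2 ka]; have a0 : (0 < a)%N by lia.
have akn : (a ^ 7 * k <= n)%N.
  by apply: leq_trans an; rewrite (expnSr a 7) leq_mul2l ka orbT.
have a67 : (100 * a ^ 6 <= a ^ 7)%N by rewrite expnS leq_mul2r a100 orbT.
pose d := (n %/ (20 * k))%N.
have k20 : (0 < 20 * k)%N by lia.
have dn : (10 * k * d.*2 <= n)%N.
  by have := leq_trunc_div n (20 * k); rewrite -/d; lia.
have da : (a ^ 6 <= d)%N.
  rewrite /d leq_divRL //; apply: leq_trans akn.
  rewrite mulnA leq_mul2r; apply/orP; right; lia.
have a60 : (0 < a ^ 6)%N by rewrite expn_gt0 a0.
apply: le_trans (few_bad_cores_block hJ (d := d) _ _ dn _) _ => //; try lia.
  apply: (@le_trans _ _ (2 ^ (4 * k))%:R).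
    rewrite -natrM ler_nat (expnM 2 4 k) -[(2 ^ 4)%N]/(4 * 4)%N expnMn leq_mul2r.
    apply/orP; right; apply: (@leq_trans (4 ^ 2)%N) => //; by rewrite leq_exp2l.
  by apply: pow2_le_expR; rewrite !natrM; lra.
set e := expR _.
rewrite mulrCA ler_pM2l; last by rewrite ltr0n; apply/card_gt0P; exists [ffun=> false].
rewrite -div1r ler_pdivlMr ?ltr0n // mulrAC -natrM /e expRN ler_pdivrMr ?expR_gt0 // mul1r.
have a2 : (a.+1 <= 2 ^ a)%N by exact: ltn_expl.
apply: (@le_trans _ _ (2 ^ (20 * a))%:R).
  rewrite ler_nat.
  apply: (@leq_trans (2 ^ 4 * 2 ^ a * (2 ^ a * 2 ^ a) * (2 ^ a) ^ 8 * (2 ^ a) ^ 8)).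
    have n8 : (n.+1 <= (2 ^ a) ^ 8)%N by apply: leq_trans na _; rewrite leq_exp2r.
    rewrite !leq_mul ?leq_exp2l //.
    by apply: leq_trans ka _; lia.
  by rewrite -!expnM -!expnD leq_exp2l //; lia.
apply: pow2_le_expR.
apply: (@le_trans _ _ (3 / 20 * (a ^ 3)%:R)).
  have : (1000 * a <= a ^ 3)%N by rewrite (expnS _ 2) mulnC leq_mul2l -mulnn; apply/orP; right; nia.
  by have := ler0n R a; set b := (a ^ 3)%N; rewrite -(ler_nat R) !natrM; lra.
rewrite ler_pM2l; last by lra.
rewrite -(@ler_pXn2r _ 2) ?nnegrE ?sqrtr_ge0 // sqr_sqrtr //.
by rewrite -natrX ler_nat -expnM; lia.
Qed.

(** From [k > a] follows [n < k ^ 8], so [10 * n ^ k <= k ^ (9 * k)], whence the constant 1800,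
    which is [200 * 9]. *)
Lemma few_bad_cores_large (R : realType) n k a (J : {set 'I_n}) (hJ : #|J| = k) q :
  (100 <= a)%N -> (n.+1 <= a.+1 ^ 8)%N -> (a < k < n)%N ->
  1800 * k%:R * ln (k%:R : R) <= q%:R ->
  #|[pred c : core n k | ~~ `[< nonadaptively_locally_correctable (of_core hJ c)
      q (1 / 1000 : R) >]]|%:R <= #|{: core n k}|%:R / n.+1%:R :> R.
Proof.
move=> a100 na /andP[ak kn] Hq.
have k100 : (100 <= k)%N by lia.
have n8 : (n.+1 <= k ^ 8)%N by apply: leq_trans na _; rewrite leq_exp2r.
have k0 : 0 < k%:R :> R by rewrite ltr0n; lia.
apply: le_trans (few_bad_cores_uniform hJ _ _) _.
- by lia.
- apply: (@le_trans _ _ (k ^ (9 * k))%:R).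
    rewrite -natrM ler_nat (mulSn 8 k) expnD (expnM k 8) leq_mul //.
      apply: (@leq_trans k); first by lia.
      by rewrite -[X in (X <= _)%N]expn1 leq_exp2l; lia.
    by rewrite leq_exp2r; lia.
  rewrite natrX -[k%:R in X in X <= _]lnK ?posrE // -expRM_natl ler_expR natrM; lra.
set e := expR _; rewrite mulrCA ler_pM2l; last by rewrite ltr0n; apply/card_gt0P; exists [ffun=> false].
rewrite -[X in _ <= X]div1r ler_pdivlMr ?ltr0n // mulrAC -natrM /e expRN ler_pdivrMr ?expR_gt0 // mul1r.
have k2 : (k <= 2 ^ k)%N by exact/ltnW/ltn_expl.
apply: (@le_trans _ _ (2 ^ (24 * k ^ 2))%:R).
  rewrite ler_nat.
  apply: (@leq_trans ((k ^ 8) ^ k * (k ^ 8) ^ k * k ^ 8)).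
    by rewrite !leq_mul ?leq_exp2r; lia.
  rewrite -!expnM -!expnD; apply: (@leq_trans ((2 ^ k) ^ (8 * k + 8 * k + 8))).
    by rewrite leq_exp2r; lia.
  by rewrite -expnM leq_exp2l // -mulnn; nia.
apply: pow2_le_expR.
have := sqr_le_pow2 k100; set b := (k ^ 2)%N; set r := (2 ^ k)%N.
by rewrite -(ler_nat R) !natrM; lra.
Qed.

Lemma exists_floor_root8 n : exists a, (a ^ 8 <= n)%N /\ (n.+1 <= a.+1 ^ 8)%N.
Proof.
elim: n => [|n [a [an na]]]; first by exists 0%N.
have [h|h] := leqP n.+2 (a.+1 ^ 8); first by exists a; split=> //; lia.
exists a.+1; split; first by lia.
by apply: leq_ltn_trans na _; rewrite ltn_exp2r.
Qed.

Theorem theorem1p2 (R : realType) :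
  exists C : R, 0 < C /\
  exists delta : nat -> R, (delta @ \oo --> (0 : R))%classic /\
  forall (n k : nat), (2 <= k < n)%N ->
  forall (J : {set 'I_n}) (hJ : #|J| = k),
    #|[set c : core n k |
        ~~ `[< exists2 q : nat,
                 q%:R <= C * k%:R * ln (k%:R : R) ^+ 2 &
                 nonadaptively_locally_correctable (of_core hJ c) q
                   (1 / 1000 : R) >]]|%:R
      / #|{: core n k}|%:R <= delta n.
Proof.
(* As [ln k >= 1/2], both [800 * k] and [1800 * k * ln k + 1] are at most [4000 * k * ln k ^+ 2]. *)
exists 4000; split => //.
(* Up to [N] the bound is trivial, as [delta n >= 1]; beyond [N] the eighth root [a] is at least
   100. *)
have [N N100] : exists N, N = (100 ^ 8)%N by exists (100 ^ 8)%N.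
exists (fun n => N.+1%:R * harmonic n); split.
  have := @cvgM R nat \oo%classic _ (fun=> N.+1%:R) (@harmonic R) N.+1%:R 0.
  rewrite mulr0; apply; [exact: cvg_cst|exact: cvg_harmonic].
move=> n k /andP[k2 kn] J hJ.
have core0 : 0 < #|{: core n k}|%:R :> R.
  by rewrite ltr0n; apply/card_gt0P; exists [ffun=> false].
have n1 : 0 < n.+1%:R :> R by rewrite ltr0n.
rewrite ler_pdivrMr // /harmonic.
have [nN|Nn] := leqP n N.
  rewrite -[X in X <= _]mul1r ler_pM // ?ler_nat ?max_card //.
  by rewrite ler_pdivlMr // mul1r ler_nat.
have h1 : 1 / 2 <= ln (k%:R : R) := ln_ge_half R k2.
have k2R : 2 <= k%:R :> R by rewrite ler_nat.
have [a [an na]] := exists_floor_root8 n.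
have a100 : (100 <= a)%N.
  have : (100 ^ 8 < a.+1 ^ 8)%N by rewrite -N100; apply: leq_trans na; lia.
  by rewrite ltn_exp2r // ltnS.
have suffq q : q%:R <= 4000 * k%:R * ln (k%:R : R) ^+ 2 ->
    #|[pred c : core n k | ~~ `[< nonadaptively_locally_correctable (of_core hJ c)
      q (1 / 1000 : R) >]]|%:R <= #|{: core n k}|%:R / n.+1%:R :> R ->
    #|[set c : core n k | ~~ `[< exists2 q : nat,
                 q%:R <= 4000 * k%:R * ln (k%:R : R) ^+ 2 &
                 nonadaptively_locally_correctable (of_core hJ c) q
                   (1 / 1000 : R) >]]|%:R <=
    N.+1%:R / n.+1%:R * #|{: core n k}|%:R :> R.
  move=> qC le; apply: (@le_trans _ _ (#|{: core n k}|%:R / n.+1%:R)).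
    apply: le_trans le; rewrite ler_nat; apply: subset_leq_card.
    apply/fintype.subsetP => c; rewrite !inE; apply: contraNN => /asboolP corr.
    by apply/asboolP; exists q.
  rewrite mulrAC ler_pM2r ?invr_gt0 // -[X in X <= _]mul1r ler_pM2r //.
  by rewrite ler1n.
have [ka|ak] := leqP k a.
  apply: (suffq (800 * k)%N); last by apply: (few_bad_cores_small _ hJ a100 an na); rewrite k2 ka.
  rewrite natrM; have : 1 / 4 <= ln (k%:R : R) ^+ 2 by nra.
  nra.
pose r : R := 1800 * k%:R * ln k%:R.
have r0 : 0 <= r by rewrite /r; nra.
have /andP[qr rq] := truncn_itv r0.
apply: (suffq (Num.truncn r).+1); last first.
  by apply: (few_bad_cores_large hJ a100 na); [rewrite ak kn|exact: ltW].
rewrite -natr1.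
move: (ln k%:R) h1 @r r0 qr {rq} => l h1 r r0 qr.
have kl : 0 <= k%:R * l * (2 * l - 1) by rewrite !mulr_ge0 //; lra.
have kl2 : 0 <= k%:R * (l - 1 / 2) * (l + 1 / 2) by rewrite !mulr_ge0 //; lra.
have qr' : (Num.truncn r)%:R <= 1800 * k%:R * l by [].
nra.
Qed.
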